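(* Let $f(\mathbf{t}) \in \mathbf{C}[\mathbf{t}] = \mathbf{C}[t_1,\ldots,t_n]$ be a nonzero polynomial. If the polynomial $g(\mathbf{t}) \in {}^{*}\mathbf{C}_0[\mathbf{t}]$ is an infinitesimal deformation of $f(\mathbf{t})$, then the nonstandard finite hypersurface ${}^{*}V_0(g)$ is an infinitesimal deformation of the hypersurface $V(f)$. Equivalently, \[ {}^{*}V_0(g) = \left\{ \mathbf{w} \in {}^{*}\mathbf{C}_0^n : {}^{\circ}\mathbf{w} \in V(f) \right\}. \]
   Context: Let ${}^{*}\mathbf{C}$ be the field of nonstandard complex numbers (a nonstandard extension of $\mathbf{C}$ in the sense of nonstandard analysis), and let ${}^{*}\mathbf{C}_0$ be its subring of finite elements (those $w$ with $|w| \le r$ for some standard real $r$). Each $w \in {}^{*}\mathbf{C}_0$ has a standard part ${}^{\circ}w \in \mathbf{C}$, the unique standard complex number with $w - {}^{\circ}w$ infinitesimal. For $w_1,w_2 \in {}^{*}\mathbf{C}$, write $w_1 \approx w_2$ if $w_1 - w_2$ is infinitesimal. For $\mathbf{w} = (w_1,\ldots,w_n) \in {}^{*}\mathbf{C}_0^n$, let ${}^{\circ}\mathbf{w} = ({}^{\circ}w_1,\ldots,{}^{\circ}w_n) \in \mathbf{C}^n$; for $\mathbf{z}\in\mathbf{C}^n$, $\mathbf{w}\approx\mathbf{z}$ means ${}^{\circ}\mathbf{w}=\mathbf{z}$. Let $\mathbf{t}=(t_1,\ldots,t_n)$ be variables. For $I=(i_1,\ldots,i_n)$ in the set $\mathbf{N}_0^n$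 of $n$-tuples of nonnegative (standard) integers, let $\mathbf{t}^I = t_1^{i_1}\cdots t_n^{i_n}$. Polynomials are ordinary polynomials, i.e. finite sums $\sum_{I\in\mathcal{I}} c_I \mathbf{t}^I$ with $\mathcal{I}$ a finite subset of $\mathbf{N}_0^n$. A polynomial $g(\mathbf{t}) = \sum_{I\in\mathcal{I}} b_I\mathbf{t}^I \in {}^{*}\mathbf{C}_0[\mathbf{t}]$ is an infinitesimal deformation of $f(\mathbf{t}) = \sum_{I\in\mathcal{I}} a_I\mathbf{t}^I \in \mathbf{C}[\mathbf{t}]$ if ${}^{\circ}b_I = a_I$ for all $I \in \mathcal{I}$. The hypersurface of $f\in\mathbf{C}[\mathbf{t}]$ is $V(f) = \{\mathbf{z}\in\mathbf{C}^n : f(\mathbf{z})=0\}$. The nonstandard finite hypersurface of $g \in {}^{*}\mathbf{C}_0[\mathbf{t}]$ is ${}^{*}V_0(g) = \{\mathbf{w}\in{}^{*}\mathbf{C}_0^n : g(\mathbf{w})\approx 0\}$. A subset $W \subseteq {}^{*}\mathbf{C}_0^n$ is an infinitesimal deformation of a subset $Z\subseteq\mathbf{C}^n$ if $W = \{\mathbf{w}\in{}^{*}\mathbf{C}_0^n : \mathbf{w}\approx\mathbf{z} \text{ for some } \mathbf{z}\in Z\} = \{\mathbf{w}\in{}^{*}\mathbf{C}_0^n : {}^{\circ}\mathbf{w}\in Z\}$. *)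

(* Defs.v *)
From HB Require Import structures.
From mathcomp Require Import all_boot all_order all_algebra.
From mathcomp Require Import complex mpoly.
From mathcomp Require Import boolp classical_sets reals.

Set Implicit Arguments.
Unset Strict Implicit.
Unset Printing Implicit Defensive.

Import Order.TTheory GRing.Theory Num.Theory.
Local Open Scope complex_scope.
Local Open Scope classical_set_scope.
Local Open Scope ring_scope.

(* First-order formulas in the full relational language of T: there is one
   k-ary symbol for every k-ary relation on T.  Functions and constants occur
   through their graphs; variables are natural numbers. *)
Inductive formula (T : Type) : Type :=
| FRel (k : nat) (A : set (k.-tuple T)) (v : k.-tuple nat)
| FEq (i j : nat)
| FNot (phi : formula T)
| FAnd (phi psi : formula T)
| FAll (i : nat) (phi : formula T).

Definition update (U : Type) (e : nat -> U) (i : nat) (x : U) : nat -> U :=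
  fun j => if j == i then x else e j.

Fixpoint sat (T U : Type) (I : forall k, set (k.-tuple T) -> set (k.-tuple U))
    (e : nat -> U) (phi : formula T) : Prop :=
  match phi with
  | FRel k A v => I k A (map_tuple e v)
  | FEq i j => e i = e j
  | FNot p => ~ sat I e p
  | FAnd p q => sat I e p /\ sat I e q
  | FAll i p => forall x : U, sat I (update e i x) p
  end.

(* Transfer says that U is an elementary extension of T in the full language;
   the last field says that the extension is proper. *)
Record nonstandard_extension (T U : Type) := NonstandardExtension {
  embed : T -> U;
  star : forall k, set (k.-tuple T) -> set (k.-tuple U);
  transfer : forall (phi : formula T) (e : nat -> T),
    sat (fun k A => A) e phi <-> sat star (embed \o e) phi;
  proper : exists w : U, forall z : T, w <> embed z }.

Definition add_graph (F : numClosedFieldType) : set (3.-tuple F) :=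
  [set t | tnth t 0 + tnth t 1 = tnth t 2].
Definition mul_graph (F : numClosedFieldType) : set (3.-tuple F) :=
  [set t | tnth t 0 * tnth t 1 = tnth t 2].
Definition norm_graph (F : numClosedFieldType) : set (2.-tuple F) :=
  [set t | `|tnth t 0| = tnth t 1].
Definition le_rel (F : numClosedFieldType) : set (2.-tuple F) :=
  [set t | tnth t 0 <= tnth t 1].

(* The field *C: a nonstandard extension of C = R[i] whose field operations,
   modulus and order are the nonstandard extensions of those of C.  As in any
   numClosedFieldType, the modulus takes its values in the field itself
   (here, in *R inside *C) and x <= y means that y - x is real nonnegative. *)
Record hypercomplex (R : realType) := Hypercomplex {
  hc_sort :> numClosedFieldType;
  hc_ext : nonstandard_extension R[i] hc_sort;
  hc_add : star hc_ext (@add_graph R[i]) = @add_graph hc_sort;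
  hc_mul : star hc_ext (@mul_graph R[i]) = @mul_graph hc_sort;
  hc_norm : star hc_ext (@norm_graph R[i]) = @norm_graph hc_sort;
  hc_le : star hc_ext (@le_rel R[i]) = @le_rel hc_sort }.

Section Definitions.
Variables (R : realType) (starC : hypercomplex R).
Local Notation C := R[i].

Definition std (z : C) : starC := embed (hc_ext starC) z.

Definition finite (w : starC) : Prop := exists r : R, `|w| <= std r%:C.

Definition infinitesimal (w : starC) : Prop :=
  forall r : R, 0 < r -> `|w| < std r%:C.

Definition approx (w1 w2 : starC) : Prop := infinitesimal (w1 - w2).

(* Junk value 0 when w is not finite. *)
Definition st (w : starC) : C := xget 0 [set z : C | infinitesimal (w - std z)].

Variable n : nat.

Definition finite_vec (w : 'I_n -> starC) : Prop := forall i, finite (w i).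

Definition st_vec (w : 'I_n -> starC) : 'I_n -> C := fun i => st (w i).

(* g has its coefficients in the subring of finite elements. *)
Definition finite_poly (g : {mpoly starC[n]}) : Prop :=
  forall m : 'X_{1..n}, finite g@_m.

(* The set s of exponents may be larger than the supports of f and g. *)
Definition poly_deformation (g : {mpoly starC[n]}) (f : {mpoly C[n]}) : Prop :=
  exists (s : seq 'X_{1..n}) (b : 'X_{1..n} -> starC) (a : 'X_{1..n} -> C),
    [/\ uniq s,
        g = \sum_(m <- s) b m *: 'X_[m],
        f = \sum_(m <- s) a m *: 'X_[m]
      & forall m, m \in s -> st (b m) = a m].

Definition hypersurface (f : {mpoly C[n]}) : set ('I_n -> C) :=
  [set z | f.@[z] = 0].

Definition finite_hypersurface (g : {mpoly starC[n]}) : set ('I_n -> starC) :=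
  [set w | finite_vec w /\ approx g.@[w] 0].

Definition set_deformation (W : set ('I_n -> starC)) (Z : set ('I_n -> C)) :=
  W = [set w | finite_vec w /\ exists2 z, Z z & st_vec w = z].

End Definitions.

(* Main.v *)
(* Transfer makes std : C -> *C an ordered-field embedding that commutes with
   the modulus, and every finite w has a standard part (the least upper bound
   of the standard reals below a real w; then real and imaginary parts).  The
   relation "w is infinitely close to std z" is compatible with sums and
   products, so g(w) is infinitely close to f(st w) for every finite w; since
   a standard number is infinitesimal only if it is 0, g(w) is infinitesimal
   exactly when f(st w) = 0. *)
From HB Require Import structures.
Require Import Defs.
From mathcomp Require Import all_boot all_order all_algebra.
From mathcomp Require Import complex mpoly.
From mathcomp Require Import boolp classical_sets reals.
From mathcomp Require Import ring.

Set Implicit Arguments.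
Unset Strict Implicit.
Unset Printing Implicit Defensive.

Import Order.TTheory GRing.Theory Num.Theory.
Local Open Scope complex_scope.
Local Open Scope classical_set_scope.
Local Open Scope ring_scope.

Section Embedding.
Variables (R : realType) (starC : hypercomplex R).
Local Notation C := R[i].
Local Notation std := (@std R starC).

(** Transfer of one atomic formula on the graph of addition, with the variables 0, 1, 2 assigned to
    [x], [y], [x + y]; [hc_add] reads the extended graph as addition in [starC]. Products, modulus
    and order follow the same pattern. *)
Lemma stdD : {morph std : x y / x + y}.
Proof.
move=> x y; have /= := transfer (hc_ext starC)
  (FRel (@add_graph C) [tuple 0; 1; 2]%N) (nth 0 [:: x; y; x + y]).
rewrite hc_add /add_graph /= !tnth_map !(tnth_nth 0%N) /=.
by case=> /(_ erefl)/esym.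
Qed.

Lemma std_is_zmod_morphism : zmod_morphism std.
Proof. by move=> x y; apply: (addIr (std y)); rewrite -stdD !subrK. Qed.

HB.instance Definition _ :=
  GRing.isZmodMorphism.Build C starC std std_is_zmod_morphism.

Lemma std_inj : injective std.
Proof.
move=> x y; have /= := transfer (hc_ext starC) (FEq _ 0%N 1%N) (nth 0 [:: x; y]).
by case.
Qed.

Lemma stdM : {morph std : x y / x * y}.
Proof.
move=> x y; have /= := transfer (hc_ext starC)
  (FRel (@mul_graph C) [tuple 0; 1; 2]%N) (nth 0 [:: x; y; x * y]).
rewrite hc_mul /mul_graph /= !tnth_map !(tnth_nth 0%N) /=.
by case=> /(_ erefl)/esym.
Qed.

Lemma std_is_monoid_morphism : monoid_morphism std.
Proof.
split; last exact: stdM.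
have std1_neq0 : std 1 != 0.
  by rewrite -(raddf0 std); apply/eqP => /std_inj /eqP; rewrite oner_eq0.
(* [std 1] is a nonzero idempotent of a field. *)
by apply: (mulfI std1_neq0); rewrite -stdM !mulr1.
Qed.

HB.instance Definition _ :=
  GRing.isMonoidMorphism.Build C starC std std_is_monoid_morphism.

Lemma norm_std z : `|std z| = std `|z|.
Proof.
have /= := transfer (hc_ext starC)
  (FRel (@norm_graph C) [tuple 0; 1]%N) (nth 0 [:: z; `|z|]).
rewrite hc_norm /norm_graph /= !tnth_map !(tnth_nth 0%N) /=.
by case=> /(_ erefl)/esym.
Qed.

Lemma ler_std : {mono std : x y / x <= y}.
Proof.
move=> x y; have /= := transfer (hc_ext starC)
  (FRel (@le_rel C) [tuple 0; 1]%N) (nth 0 [:: x; y]).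
rewrite hc_le /le_rel /= !tnth_map !(tnth_nth 0%N) /= => std_le.
by apply/idP/idP => /std_le.
Qed.

Lemma ltr_std : {mono std : x y / x < y}.
Proof. exact: leW_mono ler_std. Qed.

Lemma real_std (x : R) : std x%:C \is Num.real.
Proof. by rewrite realE -(raddf0 std) !ler_std !lecR -realE num_real. Qed.

Lemma infinitesimal0 : infinitesimal (0 : starC).
Proof. by move=> r r0; rewrite normr0 -(raddf0 std) ltr_std ltcR. Qed.

Lemma infinitesimalD (x y : starC) :
  infinitesimal x -> infinitesimal y -> infinitesimal (x + y).
Proof.
move=> hx hy r r0; apply: (le_lt_trans (ler_normD _ _)).
have r20 : 0 < r / 2 by rewrite divr_gt0.
by rewrite (splitr r) !rmorphD /= ltrD ?hx ?hy.
Qed.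

Lemma infinitesimalN (x : starC) : infinitesimal x -> infinitesimal (- x).
Proof. by move=> hx r r0; rewrite normrN hx. Qed.

Lemma infinitesimal_finite (x : starC) : infinitesimal x -> finite x.
Proof. by move=> hx; exists 1; apply/ltW/hx. Qed.

Lemma infinitesimalMr (x y : starC) :
  infinitesimal x -> finite y -> infinitesimal (x * y).
Proof.
move=> hx [r hr] e e0.
have r0 : 0 <= r.
  by rewrite -lecR -ler_std rmorph0 (le_trans _ hr).
have r1 : 0 < r + 1 by rewrite ltr_wpDl.
(* The bound [r] may be 0, so the division is by [r + 1]. *)
have -> : e = e / (r + 1) * (r + 1) by rewrite divfK ?gt_eqF.
rewrite normrM 2!rmorphM /= ltr_pM ?hx ?divr_gt0 //.
by apply: (le_lt_trans hr); rewrite ltr_std ltcR ltrDl.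
Qed.

Lemma finite_std z : finite (std z).
Proof.
have /complex_realP[r zr] := normr_real z.
by exists r; rewrite norm_std zr.
Qed.

Lemma infinitesimal_std z : infinitesimal (std z) -> z = 0.
Proof.
have /complex_realP[r zr] := normr_real z.
have [-> // | z0 zI] := eqVneq z 0.
have r0 : 0 < r by rewrite -ltcR -zr normr_gt0.
(* The modulus of [z] itself serves as the test radius. *)
by have := zI r r0; rewrite norm_std zr ltxx.
Qed.

(** The standard part as a relation, which avoids the default value of [st]. *)
Definition near (w : starC) (z : C) := infinitesimal (w - std z).

Lemma near_std z : near (std z) z.
Proof. by rewrite /near subrr; apply: infinitesimal0. Qed.

Lemma nearD w1 w2 z1 z2 : near w1 z1 -> near w2 z2 -> near (w1 + w2) (z1 + z2).
Proof.
move=> h1 h2; rewrite /near stdD opprD addrACA.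
exact: infinitesimalD.
Qed.

Lemma nearM w1 w2 z1 z2 : near w1 z1 -> near w2 z2 -> near (w1 * w2) (z1 * z2).
Proof.
rewrite /near => h1 h2.
(* Each of the three products has an infinitesimal first factor and a finite second one. *)
have -> : w1 * w2 - std (z1 * z2) = (w1 - std z1) * (w2 - std z2)
    + ((w1 - std z1) * std z2 + (w2 - std z2) * std z1).
  by rewrite stdM; ring.
apply: infinitesimalD; last apply: infinitesimalD.
- exact/infinitesimalMr/infinitesimal_finite.
- exact/infinitesimalMr/finite_std.
- exact/infinitesimalMr/finite_std.
Qed.

Lemma near_sum (I : eqType) (s : seq I) (F : I -> starC) (G : I -> C) :
  (forall i, i \in s -> near (F i) (G i)) ->
  near (\sum_(i <- s) F i) (\sum_(i <- s) G i).
Proof.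
move=> FG; rewrite !big_seq; apply: (big_rec2 near) => [|i w z si].
  by rewrite -(raddf0 std); apply: near_std.
exact/nearD/FG.
Qed.

Lemma near1 : near 1 1.
Proof. by rewrite -(rmorph1 std); apply: near_std. Qed.

Lemma near_prod (I : finType) (F : I -> starC) (G : I -> C) :
  (forall i, near (F i) (G i)) -> near (\prod_i F i) (\prod_i G i).
Proof.
move=> FG; apply: (big_rec2 near) => [|i w z _]; first exact: near1.
exact/nearM/FG.
Qed.

Lemma nearX w z k : near w z -> near (w ^+ k) (z ^+ k).
Proof.
move=> wz; elim: k => [|k IHk]; first exact: near1.
by rewrite !exprS; apply: nearM.
Qed.

(** If [w] is infinitesimal, so is [std z = w - (w - std z)], and 0 is the only infinitesimal
    standard number. *)
Lemma near_infinitesimal w z : near w z -> infinitesimal w <-> z = 0.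
Proof.
move=> wz; split=> [w0 | z0]; last by move: wz; rewrite /near z0 raddf0 subr0.
apply: infinitesimal_std.
rewrite -(subKr w (std z)).
exact/infinitesimalD/infinitesimalN.
Qed.

Lemma finite_real_near (w : starC) :
  w \is Num.real -> finite w -> exists x : R, near w x%:C.
Proof.
move=> wR [r]; rewrite real_ler_norml // => /andP[rw wr].
pose E := [set x : R | std x%:C <= w].
have ubE : ubound E r.
  by move=> x Ex; rewrite -lecR -ler_std (le_trans Ex).
have supE : has_sup E.
  split; last by exists r.
  by exists (- r); rewrite /E /= !rmorphN.
exists (sup E) => e e0.
rewrite real_ltr_distl ?rpredB ?real_std // -rmorphB -rmorphD /=.
rewrite -!rmorphB -!rmorphD /=; apply/andP; split.
  have [x Ex ltx] := sup_adherent e0 supE.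
  by apply: lt_le_trans Ex; rewrite ltr_std ltcR.
(* Otherwise [sup E + e] would belong to [E]. *)
rewrite real_ltNge ?real_std //; apply/negP => /(sup_upper_bound supE).
by rewrite gerDl leNgt e0.
Qed.

(* The embedding may swap 'i and - 'i. *)
Lemma imaginary_std : exists z, std z = 'i.
Proof.
have : (std 'i) ^+ 2 == ('i : starC) ^+ 2.
  by rewrite -rmorphXn /= !sqrCi rmorphN1.
rewrite eqf_sqr => /orP[] /eqP stdi; first by exists 'i.
by exists (- 'i); rewrite rmorphN /= stdi opprK.
Qed.

Lemma finite_near (w : starC) : finite w -> exists z, near w z.
Proof.
move=> [r wr].
have [|x wx] := finite_real_near (Creal_Re w).
  by exists r; apply: le_trans wr; rewrite leif_normC_Re_Creal.
have [|y wy] := finite_real_near (Creal_Im w).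
  exists r; apply: le_trans wr.
  (* Up to sign, the imaginary part of [w] is the real part of ['i * w], which has the same modulus
     as [w]. *)
  by rewrite -normrN -ReMil (le_trans (leif_normC_Re_Creal _)) // normrM normCi mul1r.
have [j stdj] := imaginary_std.
(* [j] is a preimage of the ['i] of [starC], so the image of the witness has the right imaginary
   part even if the embedding conjugates ['i]. *)
exists (x%:C + j * y%:C); rewrite [w]Crect -stdj.
exact/nearD/nearM/wy/near_std.
Qed.

Lemma near_st (w : starC) : finite w -> near w (st w).
(* A nearby standard point exists, so [xget] does not fall back on its default 0. *)
Proof. by move/finite_near/(xgetPex 0). Qed.

End Embedding.

(** Identifies [b m] with a coefficient of [g], so that finiteness of [g] passes to [b m]; [uniq s]
    keeps a monomial from being counted twice. *)
Lemma mcoeff_sum_monomials (A : nzRingType) (n : nat) (s : seq 'X_{1..n})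
    (c : 'X_{1..n} -> A) (m : 'X_{1..n}) :
  uniq s -> m \in s -> (\sum_(k <- s) c k *: 'X_[k])@_m = c m.
Proof.
move=> us ms; rewrite raddf_sum /= (bigD1_seq m) //= mcoeffZ mcoeffX eqxx mulr1.
rewrite big1 ?addr0 // => k /negPf km.
by rewrite mcoeffZ mcoeffX km mulr0.
Qed.

Lemma near_meval (R : realType) (starC : hypercomplex R) (n : nat)
    (f : {mpoly R[i][n]}) (g : {mpoly starC[n]}) (w : 'I_n -> starC) :
  finite_poly g -> poly_deformation g f -> finite_vec w ->
  near g.@[w] f.@[st_vec w].
Proof.
move=> fin_g [s [b [a [us gE fE ba]]]] fin_w.
have near_b m : m \in s -> near (b m) (a m).
  move=> ms; rewrite -ba //; apply: near_st.
  by rewrite -(mcoeff_sum_monomials b us ms) -gE; apply: fin_g.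
rewrite gE fE !raddf_sum /=; apply: near_sum => m ms.
rewrite !mevalZ !mevalX; apply: nearM; first exact: near_b.
by apply: near_prod => i; apply/nearX/near_st/fin_w.
Qed.

Theorem theorem1 (R : realType) (starC : hypercomplex R) (n : nat)
    (f : {mpoly R[i][n]}) (g : {mpoly starC[n]}) :
  f <> 0 -> finite_poly g -> poly_deformation g f ->
  set_deformation (finite_hypersurface g) (hypersurface f) /\
  finite_hypersurface g =
    [set w : 'I_n -> starC | finite_vec w /\ hypersurface f (st_vec w)].
Proof.
move=> _ fin_g def_g.
have hypE : finite_hypersurface g =
    [set w : 'I_n -> starC | finite_vec w /\ hypersurface f (st_vec w)].
  apply/seteqP; split=> w [fin_w];
    have nearP := near_infinitesimal (near_meval fin_g def_g fin_w).
    by rewrite /approx subr0 => /nearP.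
  by move=> /nearP; split=> //; rewrite /approx subr0.
split=> //; rewrite /set_deformation hypE.
(* The point [z] of [set_deformation] can only be [st_vec w]. *)
apply/seteqP; split=> w [fin_w fw]; split=> //; first by exists (st_vec w).
by case: fw => z fz ->.
Qed.
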